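(* Let $f:\mathbf{R}^N\to\mathbf{R}$ be partially separable, $f=\sum_{J\in\mathcal{J}}f_J$, with block Lipschitz gradient with constants $L=(L_1,\dots,L_n)$. Let $\hat S$ be a nonoverlapping uniform sampling, corresponding to a partition $S^1,\dots,S^l$ of $[n]$ into nonempty sets. For $i\in S^j$ define $\gamma_i=\max_{J\in\mathcal{J}}|J\cap S^j|$, and let $\gamma=(\gamma_1,\dots,\gamma_n)$. Then $$(f,\hat S)\sim ESO(1,\gamma\odot L).$$ Moreover, this ESO is monotonic: if $\Omega:\mathbf{R}^N\to\mathbf{R}\cup\{+\infty\}$ is proper, closed, convex and block separable, and $F=f+\Omega$, then, with $\beta=1$ and $w=\gamma\odot L$, one has $F(x+(h(x))_{[\hat S]})\le F(x)$ with probability 1 for all $x\in\operatorname{dom}F$.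
   Context: Blocks: $[n]=\{1,\dots,n\}$; $N=N_1+\dots+N_n$ with $N_i\ge1$; $U=[U_1,\dots,U_n]$ is a column permutation of the $N\times N$ identity matrix, with $U_i$ of size $N\times N_i$. For $x\in\mathbf{R}^N$, the $i$-th block is $x^{(i)}=U_i^Tx\in\mathbf{R}^{N_i}$, and for $S\subseteq[n]$, $x_{[S]}=\sum_{i\in S}U_ix^{(i)}$. $\langle\cdot,\cdot\rangle$ is the Euclidean inner product. For fixed symmetric positive definite matrices $B_i\in\mathbf{R}^{N_i\times N_i}$, $\|t\|_{(i)}=\langle B_it,t\rangle^{1/2}$ and $\|t\|_{(i)}^*=\langle B_i^{-1}t,t\rangle^{1/2}$. For a weight vector $w\in\mathbf{R}^n$, $\|x\|_w=(\sum_{i=1}^nw_i\|x^{(i)}\|_{(i)}^2)^{1/2}$. For $w,z\in\mathbf{R}^n$, $w\odot z=(w_1z_1,\dots,w_nz_n)$. Partially separable: $f=\sum_{J\in\mathcal{J}}f_J$, where $\mathcal{J}$ is a finite collection, possibly with repetitions, of nonempty subsets of $[n]$, and each $f_J:\mathbf{R}^N\to\mathbf{R}$ is convex, differentiable and depends on the blocks $x^{(i)}$, $i\in J$, only. Block Lipschitz gradient with constants $L_1,\dots,L_n>0$: $\|U_i^T\nabla f(x+U_it)-U_i^T\nabla f(x)\|_{(i)}^*\le L_i\|t\|_{(i)}$ for all $x\in\mathbf{R}^N$, $i\in[n]$, $t\in\mathbf{R}^{N_i}$. A sampling is a random subset of $[n]$. The nonoverlapping uniform sampling corresponding to a partition $S^1,\dots,S^l$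 of $[n]$ (all $S^j\ne\emptyset$) satisfies $\mathbf{P}(\hat S=S^j)=1/l$ for $j=1,\dots,l$ (and $\mathbf{P}(\hat S=S)=0$ for all other $S$). A sampling is proper if $\mathbf{P}(i\in\hat S)>0$ for all $i$, and uniform if $\mathbf{P}(i\in\hat S)$ does not depend on $i$. ESO (expected separable overapproximation): for $\beta>0$, a weight vector $w$ (the general definition takes $w$ with positive entries) and a proper uniform sampling $\hat S$, $(f,\hat S)\sim ESO(\beta,w)$ means that for all $x,h\in\mathbf{R}^N$, $$\mathbf{E}[f(x+h_{[\hat S]})]\le f(x)+\tfrac{\mathbf{E}[|\hat S|]}{n}\left(\langle\nabla f(x),h\rangle+\tfrac\beta2\|h\|_w^2\right).$$ Block separable: $\Omega(x)=\sum_{i=1}^n\Omega_i(x^{(i)})$ with $\Omega_i:\mathbf{R}^{N_i}\to\mathbf{R}\cup\{+\infty\}$ closed and convex. $\operatorname{dom}F=\{x:F(x)<+\infty\}$. $h(x)=\arg\min_{h\in\mathbf{R}^N}\{f(x)+\langle\nabla f(x),h\rangle+\frac\beta2\|h\|_w^2+\Omega(x+h)\}$. *)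

(* Defs.v *)
From HB Require Import structures.
From mathcomp Require Import all_boot all_order all_algebra perm.
From mathcomp Require Import all_classical all_reals all_analysis.

Set Implicit Arguments.
Unset Strict Implicit.
Unset Printing Implicit Defensive.

Import Order.TTheory GRing.Theory Num.Theory.
Import numFieldNormedType.Exports.

Local Open Scope classical_set_scope.
Local Open Scope ring_scope.

Section Euclidean.
Context {R : realType}.

Definition dot m (u v : 'cV[R]_m) : R := \sum_(k < m) u k 0 * v k 0.

Definition spd_mx m (A : 'M[R]_m) : Prop :=
  A^T = A /\ forall t : 'cV[R]_m, t != 0 -> 0 < dot (A *m t) t.

(* The vector of partial derivatives; it is used for differentiable f only. *)
Definition grad m (f : 'cV[R]_m -> R) (x : 'cV[R]_m) : 'cV[R]_m :=
  \col_(k < m) 'D_(delta_mx k 0) f x.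

(* Functions with values in R \cup {+oo}; the library's convex_function covers
   real-valued functions only. In \bar R, 0 * +oo = 0, so the inequality below
   is trivial at t = 0 and t = 1. *)
Definition ninfty_free m (g : 'cV[R]_m -> \bar R) : Prop :=
  forall x, (-oo < g x)%E.

Definition econvex m (g : 'cV[R]_m -> \bar R) : Prop :=
  forall (x y : 'cV[R]_m) (t : R), 0 <= t <= 1 ->
    (g (t *: x + (1 - t) *: y)%R <= t%:E * g x + (1 - t)%:E * g y)%E.

Definition closed_fun m (g : 'cV[R]_m -> \bar R) : Prop :=
  closed [set z : 'cV[R]_m * R | (g z.1 <= z.2%:E)%E].

Definition edom m (g : 'cV[R]_m -> \bar R) : set 'cV[R]_m :=
  [set x | (g x < +oo)%E].

Definition proper_fun m (g : 'cV[R]_m -> \bar R) : Prop :=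
  ninfty_free g /\ edom g !=set0.

End Euclidean.

(* Block i has size p i, the ambient dimension is N = \sum_i p i, and the
   column permutation U = [U_1, ..., U_n] of the identity is given by s. *)
Section Blocks.
Context {R : realType} {n : nat} {p : 'I_n -> nat}.
Local Notation N := (\sum_(i < n) p i)%N.
Variable s : 'S_N.

Definition Ublk (i : 'I_n) : 'M[R]_(N, p i) :=
  submxrow (col_perm s 1%:M) i.

Definition blk (x : 'cV[R]_N) (i : 'I_n) : 'cV[R]_(p i) := (Ublk i)^T *m x.

Definition restr (x : 'cV[R]_N) (S : {set 'I_n}) : 'cV[R]_N :=
  \sum_(i in S) Ublk i *m blk x i.

Variable B : forall i : 'I_n, 'M[R]_(p i).

Definition bnorm (i : 'I_n) (t : 'cV[R]_(p i)) : R :=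
  Num.sqrt (dot (B i *m t) t).

Definition bnorm_dual (i : 'I_n) (t : 'cV[R]_(p i)) : R :=
  Num.sqrt (dot (invmx (B i) *m t) t).

Definition wnorm (w : 'I_n -> R) (x : 'cV[R]_N) : R :=
  Num.sqrt (\sum_(i < n) w i * bnorm (blk x i) ^+ 2).

Definition wmul (w z : 'I_n -> R) : 'I_n -> R := fun i => w i * z i.

Definition block_lipschitz (f : 'cV[R]_N -> R) (L : 'I_n -> R) : Prop :=
  forall (x : 'cV[R]_N) (i : 'I_n) (t : 'cV[R]_(p i)),
    bnorm_dual (blk (grad f (x + Ublk i *m t)) i - blk (grad f x) i)
      <= L i * bnorm t.

Definition depends_only_on (g : 'cV[R]_N -> R) (J : {set 'I_n}) : Prop :=
  forall x y : 'cV[R]_N, (forall i, i \in J -> blk x i = blk y i) -> g x = g y.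

(* The collection of subsets is a finite family, so repetitions are allowed. *)
Definition partially_separable (f : 'cV[R]_N -> R) (K : finType)
    (J : K -> {set 'I_n}) (fJ : K -> 'cV[R]_N -> R) : Prop :=
  (forall x, f x = \sum_(k : K) fJ k x) /\
  forall k : K, [/\ J k != finset.set0,
    convex_function [set: convex_lmodType 'cV[R]_N] (fJ k),
    forall x, differentiable (fJ k) x &
    depends_only_on (fJ k) (J k)].

Definition block_separable (Omega : 'cV[R]_N -> \bar R) : Prop :=
  exists Om : forall i : 'I_n, 'cV[R]_(p i) -> \bar R,
    (forall i, [/\ ninfty_free (Om i), closed_fun (Om i) & econvex (Om i)]) /\
    forall x, Omega x = (\sum_(i < n) Om i (blk x i))%E.

Definition composite (f : 'cV[R]_N -> R) (Omega : 'cV[R]_N -> \bar R)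
  (x : 'cV[R]_N) : \bar R := ((f x)%:E + Omega x)%E.

Definition model (f : 'cV[R]_N -> R) (Omega : 'cV[R]_N -> \bar R) (beta : R)
    (w : 'I_n -> R) (x h : 'cV[R]_N) : \bar R :=
  ((f x + dot (grad f x) h + beta / 2 * wnorm w h ^+ 2)%:E
     + Omega (x + h)%R)%E.

(* Weights may vanish, so a minimiser need not exist or be unique: h(x) is
   rendered as an arbitrary element of the argmin set. *)
Definition is_argmin_model (f : 'cV[R]_N -> R) (Omega : 'cV[R]_N -> \bar R)
    (beta : R) (w : 'I_n -> R) (x h : 'cV[R]_N) : Prop :=
  forall h' : 'cV[R]_N,
    (model f Omega beta w x h <= model f Omega beta w x h')%E.

End Blocks.

Section Sampling.
Context {R : realType} {n : nat}.
Context {d : measure_display} {T : measurableType d}.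
Variables (P : probability T R) (S : T -> {set 'I_n}).

Definition is_sampling : Prop :=
  forall A : {set 'I_n}, measurable [set t | S t = A].

Definition proper_sampling : Prop :=
  forall i : 'I_n, (0 < P [set t | i \in S t])%E.

Definition uniform_sampling : Prop :=
  forall i j : 'I_n, P [set t | i \in S t] = P [set t | j \in S t].

(* Q is the set {S^1, ..., S^l}, hence l = #|Q|. *)
Definition nonoverlapping_uniform (Q : {set {set 'I_n}}) : Prop :=
  [/\ is_sampling,
      finset.partition Q [set: 'I_n]%SET &
      forall A : {set 'I_n},
        P [set t | S t = A] = (if A \in Q then #|Q|%:R^-1 else 0)%:E].

Context {p : 'I_n -> nat}.
Local Notation N := (\sum_(i < n) p i)%N.
Variables (s : 'S_N) (B : forall i : 'I_n, 'M[R]_(p i)).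

Definition ESO (f : 'cV[R]_N -> R) (beta : R) (w : 'I_n -> R) : Prop :=
  [/\ 0 < beta, proper_sampling, uniform_sampling &
  forall x h : 'cV[R]_N,
    ('E_P[(fun t => f (x + restr s h (S t)))%R] <=
     (f x)%:E + 'E_P[(fun t => #|S t|%:R)%R] * (n%:R^-1)%:E *
       (dot (grad f x) h + beta / 2 * wnorm s B w h ^+ 2)%:E)%E].

Definition ESO_monotonic (f : 'cV[R]_N -> R) (Omega : 'cV[R]_N -> \bar R)
    (beta : R) (w : 'I_n -> R) : Prop :=
  forall x h : 'cV[R]_N, edom (composite f Omega) x ->
    is_argmin_model s B f Omega beta w x h ->
    {ae P, forall t,
      (composite f Omega (x + restr s h (S t))%R <= composite f Omega x)%E}.

End Sampling.

(* pblock Q i is the cell S^j of the partition Q that contains i. *)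
Definition gamma_weight {R : realType} {n : nat} (Q : {set {set 'I_n}})
    (K : finType) (J : K -> {set 'I_n}) (i : 'I_n) : R :=
  (\max_(k : K) #|J k :&: finset.pblock Q i|)%N%:R.

(* Main.v *)
Require Import Defs.
From HB Require Import structures.
From mathcomp Require Import all_boot all_order all_algebra perm.
From mathcomp Require Import all_classical all_reals all_analysis.
From mathcomp Require Import ring lra.

(* Fix a cell [A] of the partition and let [m] be the maximum of |J_k :&: A|.
   Each [f_k] sees at most [m] of the blocks of the displacement [h_A], so
   [x + h_A] may be replaced by the average of [m] points, namely
   [x + m U_i h^(i)] for [i] in [J_k :&: A] and copies of [x].  Convexity, summed
   over [k], gives
     f (x + h_A) <= f x + m^-1 \sum_(i in A) (f (x + m U_i h^(i)) - f x),
   and the block Lipschitz condition bounds each difference quadratically (if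
   [m = 0], [f] is constant along [h_A] and there is nothing to bound).  The
   result is a deterministic bound on every cell; averaging it over the cells
   gives the ESO, and since the model is separable it also gives monotonicity. *)

Set Implicit Arguments.
Unset Strict Implicit.
Unset Printing Implicit Defensive.

Import Order.TTheory GRing.Theory Num.Theory.
Import numFieldNormedType.Exports.

Local Open Scope ring_scope.

(** * Euclidean inner product and positive definite forms *)

Section DotTheory.
Variable R : realType.

Lemma dotE m (u v : 'cV[R]_m) : dot u v = (u^T *m v) 0 0.
Proof. by rewrite mxE; apply: eq_bigr => k _; rewrite mxE. Qed.

Lemma dotC m (u v : 'cV[R]_m) : dot u v = dot v u.
Proof. by apply: eq_bigr => k _; rewrite mulrC. Qed.

Lemma dotDr m (u v w : 'cV[R]_m) : dot u (v + w) = dot u v + dot u w.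
Proof. by rewrite !dotE mulmxDr mxE. Qed.

Lemma dotDl m (u v w : 'cV[R]_m) : dot (u + v) w = dot u w + dot v w.
Proof. by rewrite dotC dotDr !(dotC w). Qed.

Lemma dotZr m (u v : 'cV[R]_m) a : dot u (a *: v) = a * dot u v.
Proof. by rewrite !dotE -scalemxAr mxE. Qed.

Lemma dotZl m (u v : 'cV[R]_m) a : dot (a *: u) v = a * dot u v.
Proof. by rewrite dotC dotZr dotC. Qed.

Lemma dotBl m (u v w : 'cV[R]_m) : dot (u - v) w = dot u w - dot v w.
Proof. by rewrite -scaleN1r dotDl dotZl mulN1r. Qed.

Lemma dot0r m (u : 'cV[R]_m) : dot u 0 = 0.
Proof. by rewrite dotE mulmx0 mxE. Qed.

Lemma dot_sumr m (u : 'cV[R]_m) (I : finType) (P : pred I)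
    (v : I -> 'cV[R]_m) :
  dot u (\sum_(i | P i) v i) = \sum_(i | P i) dot u (v i).
Proof.
by rewrite dotE mulmx_sumr summxE; apply: eq_bigr => i _; rewrite dotE.
Qed.

Lemma dot_trmx m k (A : 'M[R]_(m, k)) (u : 'cV[R]_m) (v : 'cV[R]_k) :
  dot (A^T *m u) v = dot u (A *m v).
Proof. by rewrite !dotE trmx_mul trmxK mulmxA. Qed.

Lemma spd_mx_ge0 m (A : 'M[R]_m) t : spd_mx A -> 0 <= dot (A *m t) t.
Proof.
case=> _ Apos; have [->|/Apos/ltW//] := eqVneq t 0; by rewrite dot0r.
Qed.

(** A vector [v] with [v *m A = 0] makes the form vanish at [v^T], by symmetry of [A]; hence the
    kernel is trivial. *)
Lemma spd_mx_unit m (A : 'M[R]_m) : spd_mx A -> A \in unitmx.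
Proof.
case=> Asym Apos; rewrite -row_free_unit -kermx_eq0.
apply/rowV0P => v /sub_kermxP vA0; apply/eqP; apply: contraT => v0.
have /Apos : v^T != 0 by apply: contra_neq v0 => /(congr1 trmx); rewrite trmxK trmx0.
by rewrite -Asym -trmx_mul vA0 trmx0 dotC dot0r ltxx.
Qed.

(* The form is evaluated at [<Av, v> u - <Au, v> v]. *)
Lemma spd_mx_cauchy_schwarz m (A : 'M[R]_m) (u v : 'cV[R]_m) : spd_mx A ->
  dot (A *m u) v <= Num.sqrt (dot (A *m u) u) * Num.sqrt (dot (A *m v) v).
Proof.
move=> Aspd; have [v0|v0] := eqVneq v 0.
  by rewrite v0 !dot0r mulr_ge0 ?sqrtr_ge0.
have b0 : 0 < dot (A *m v) v by case: Aspd => _; apply.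
have Auv : dot (A *m v) u = dot (A *m u) v.
  by case: Aspd => Asym _; rewrite -{1}Asym dot_trmx dotC.
rewrite -sqrtrM ?spd_mx_ge0//.
set a := dot (A *m u) u; set b := dot (A *m v) v in b0 *.
set c := dot (A *m u) v in Auv *.
have := spd_mx_ge0 (b *: u - c *: v) Aspd.
rewrite mulmxBr -!scalemxAr dotBl dotDr -scaleNr !dotZl !dotDr !dotZr.
rewrite Auv -/a -/b -/c => H.
have {}H : 0 <= b * (a * b - c ^+ 2) by move: H; congr (0 <= _); ring.
rewrite pmulr_rge0// subr_ge0 in H.
by rewrite (le_trans (ler_norm c))// -sqrtr_sqr ler_wsqrtr.
Qed.

End DotTheory.

(** * Block decomposition of vectors *)

Section BlockAlgebra.
Context {R : realType} {n : nat} {p : 'I_n -> nat}.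
Local Notation N := (\sum_(i < n) p i)%N.
Variable s : 'S_N.

Lemma blkD (x y : 'cV[R]_N) i : blk s (x + y) i = blk s x i + blk s y i.
Proof. exact: mulmxDr. Qed.

Lemma blkZ a (x : 'cV[R]_N) i : blk s (a *: x) i = a *: blk s x i.
Proof. by rewrite /blk scalemxAr. Qed.

(** Permutation matrices are orthogonal, so products of the column slices are blocks of the
    identity: this encodes the orthonormality of the [U_i]. *)
Lemma Ublk_tr_mul (i j : 'I_n) :
  (Ublk s i)^T *m Ublk s j = submxblock (1%:M : 'M[R]_N) i j.
Proof.
rewrite /Ublk tr_submxrow submxcol_mul col_permE mul1mx.
have <- : (perm_mx s^-1)^T *m perm_mx s^-1 = 1%:M :> 'M[R]_N.
  by rewrite tr_perm_mx -perm_mxM mulVg perm_mx1.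
by apply/matrixP => a b; rewrite !mxE; apply: eq_bigr => k _; rewrite !mxE.
Qed.

Lemma blk_Ublk i (t : 'cV[R]_(p i)) : blk s (Ublk s i *m t) i = t.
Proof.
rewrite /blk mulmxA Ublk_tr_mul -(mxdiagZ 1) mxblockK.
by rewrite conform_mx_id eqxx mul1mx.
Qed.

Lemma blk_Ublk_neq i j (t : 'cV[R]_(p i)) :
  j != i -> blk s (Ublk s i *m t) j = 0.
Proof.
move=> /negPf ji.
by rewrite /blk mulmxA Ublk_tr_mul -(mxdiagZ 1) mxblockK ji mul0mx.
Qed.

(** The sum of the [U_i U_i^T] is [U U^T], which is the identity because [U] is a permutation
    matrix. *)
Lemma sum_Ublk_blk (x : 'cV[R]_N) : \sum_i Ublk s i *m blk s x i = x.
Proof.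
have UUT : \sum_i Ublk s i *m (Ublk s i)^T = 1%:M :> 'M[R]_N.
  transitivity ((\mxrow_i @Ublk R n p s i) *m (\mxrow_i @Ublk R n p s i)^T).
    by rewrite tr_mxrow mul_mxrow_mxcol.
  rewrite submxrowK col_permE mul1mx.
  by rewrite tr_perm_mx -perm_mxM mulgV perm_mx1.
rewrite -[RHS]mul1mx -UUT mulmx_suml; apply: eq_bigr => i _.
by rewrite /blk mulmxA.
Qed.

Lemma blk_restr (x : 'cV[R]_N) (A : {set 'I_n}) i :
  blk s (restr s x A) i = if i \in A then blk s x i else 0.
Proof.
rewrite /restr {1}/blk mulmx_sumr; case: ifPn => iA.
  rewrite (bigD1 i)//= -/(blk s _ i) blk_Ublk big1 ?addr0// => j /andP[_ ji].
  by rewrite -/(blk s _ i) blk_Ublk_neq// eq_sym.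
rewrite big1// => j jA; rewrite -/(blk s _ i) blk_Ublk_neq//.
by apply: contraNneq iA => ->.
Qed.

Lemma dot_blk (x y : 'cV[R]_N) :
  dot x y = \sum_i dot (blk s x i) (blk s y i).
Proof.
rewrite -{1}(sum_Ublk_blk y) dot_sumr; apply: eq_bigr => i _.
by rewrite -dot_trmx.
Qed.

Lemma blk_ext (x y : 'cV[R]_N) : (forall i, blk s x i = blk s y i) -> x = y.
Proof.
by move=> xy; rewrite -(sum_Ublk_blk x) -(sum_Ublk_blk y);
  apply: eq_bigr => i _; rewrite xy.
Qed.

Lemma wnorm_sqr (B : forall i, 'M[R]_(p i)) (w : 'I_n -> R) (x : 'cV[R]_N) :
  (forall i, 0 <= w i) ->
  wnorm s B w x ^+ 2 = \sum_i w i * bnorm B (blk s x i) ^+ 2.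
Proof.
by move=> w0; rewrite sqr_sqrtr// sumr_ge0// => i _; rewrite mulr_ge0// sqr_ge0.
Qed.

End BlockAlgebra.

(** * Differentiation along lines and convexity *)

Section Smooth.
Variable R : realType.

(** Expand [v] in the canonical basis and use linearity of the differential. *)
Lemma dot_grad m (f : 'cV[R]_m -> R) (x v : 'cV[R]_m) :
  differentiable f x -> dot (grad f x) v = 'D_v f x.
Proof.
move=> df; rewrite deriveE// [in RHS](matrix_sum_delta v) linear_sum.
apply: eq_bigr => k _; rewrite big_ord1 linearZ/= mxE deriveE//.
by rewrite mulrC.
Qed.

(** Serves to transfer both the existence and the value of a directional derivative to the
    one-variable restriction. *)
Lemma derive_line_eq m (f : 'cV[R]_m -> R) (x v : 'cV[R]_m) (a : R) :
  (fun h : R => h^-1 *: (((fun b : R => f (x + b *: v)) \o shift a) (h *: 1) -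
     f (x + a *: v))) =
  (fun h : R => h^-1 *: ((f \o shift (x + a *: v)) (h *: v) - f (x + a *: v))).
Proof.
apply/funext => h /=; congr (_ *: (f _ - _)).
by rewrite scalerDl addrCA /GRing.scale/= mulr1.
Qed.

Lemma is_derive_line m (f : 'cV[R]_m -> R) (x v : 'cV[R]_m) (a : R) :
  differentiable f (x + a *: v) ->
  is_derive a 1 (fun b : R => f (x + b *: v)) (dot (grad f (x + a *: v)) v).
Proof.
move=> df; apply: DeriveDef.
  by rewrite /derivable derive_line_eq; exact: diff_derivable.
by rewrite dot_grad// /derive derive_line_eq.
Qed.

(** Subtract the quadratic [d * a + c / 2 * a ^+ 2] from [f] on the line: the slope hypothesis makes
    the difference [phi] nonincreasing on [0,1], which avoids any integration. *)
Lemma descent_line m (f : 'cV[R]_m -> R) (x v : 'cV[R]_m) (c : R) :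
  (forall y, differentiable f y) ->
  (forall a : R, 0 <= a ->
     dot (grad f (x + a *: v) - grad f x) v <= c * a) ->
  f (x + v) <= f x + dot (grad f x) v + c / 2.
Proof.
move=> df gradf; set d := dot (grad f x) v.
pose phi : R -> R := (fun a : R => f (x + a *: v)) - (fun a => d * a + c / 2 * a ^+ 2).
have dphi (a : R) : is_derive a 1 phi (dot (grad f (x + a *: v)) v - (d + c * a)).
  apply: is_deriveB; first exact: is_derive_line.
  have -> : (fun a0 : R => d * a0 + c / 2 * a0 ^+ 2) =
    (d \*: id) + ((c / 2) \*: (id ^+ 2)) :> (R -> R).
    by apply/funext => b; rewrite !fctE.
  apply: is_derive_eq.
  by rewrite /GRing.scale/=; field.
have : phi 1 <= phi 0.
  apply: (@ler0_derive1_le_cc R phi 0 1); rewrite ?in_itv//= ?lexx ?ler01//.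
  - by move=> a; rewrite in_itv/= => /andP[/ltW/gradf + _];
      rewrite derive1E derive_val dotBl -/d; lra.
  - apply: derivable_within_continuous => a _; exact: ex_derive.
rewrite /phi !fctE; rewrite scale1r scale0r addr0; lra.
Qed.

Lemma convex_functionE m (g : 'cV[R]_m -> R) :
  convex_function [set: convex_lmodType 'cV[R]_m]%classic g ->
  forall (t : R) x y, 0 <= t <= 1 ->
    g (t *: x + (1 - t) *: y) <= t * g x + (1 - t) * g y.
Proof.
move=> cg t x y /andP[t0 t1].
by apply: (cg (Itv01 t0 t1) x y); rewrite inE.
Qed.

(* Jensen's inequality with [m.+1] equal weights, the missing points of [r]
   being copies of [x]. *)
Lemma convex_jensen m (g : 'cV[R]_m -> R) (x : 'cV[R]_m)
    (I : Type) (r : seq I) (u : I -> 'cV[R]_m) (k : nat) :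
  convex_function [set: convex_lmodType 'cV[R]_m]%classic g ->
  (size r <= k.+1)%N ->
  g (x + k.+1%:R^-1 *: \sum_(i <- r) u i) <=
    g x + k.+1%:R^-1 * \sum_(i <- r) (g (x + u i) - g x).
Proof.
move=> /convex_functionE cg; elim: r k => [|a r IH] k /=.
  by rewrite !big_nil scaler0 mulr0 !addr0.
rewrite !big_cons ltnS; case: k => [|k] rk.
  (* With a single weight, the size bound leaves only the point [x + u a]. *)
  case: r IH rk => // _ _.
  rewrite !big_nil invr1 scale1r !addr0; lra.
have := IH _ rk; set U := \sum_(j <- r) u j; set G := \sum_(j <- r) _ => {}IH.
set t : R := k.+2%:R^-1.
have k1 : k.+1%:R != 0 :> R by rewrite pnatr_eq0.
have k2 : k.+2%:R != 0 :> R by rewrite pnatr_eq0.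
(* Splitting off [x + u a] with weight [t] leaves an average of [k.+1] points with total weight
   [1 - t]; each then has weight [t] again. *)
have tE : (1 - t) * k.+1%:R^-1 = t.
  apply: (mulIf k1); rewrite divfK// -{1}(mulVf k2) -[X in _ - X]mulr1 -mulrBr.
  by rewrite -[k.+2%:R in X in _ * X]natr1 addrK.
have t01 : 0 <= t <= 1 by rewrite invr_ge0 ler0n/= invf_le1 ?ltr0n// ler1n.
have -> : x + t *: (u a + U) = t *: (x + u a) + (1 - t) *: (x + k.+1%:R^-1 *: U).
  rewrite scalerDr [(1 - t) *: _]scalerDr scalerA tE scalerDr addrACA -scalerDl.
  by rewrite [t + _]addrC subrK scale1r.
apply: le_trans (cg _ _ _ t01) _.
have t1 : 0 <= 1 - t by rewrite subr_ge0; case/andP: t01.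
have := ler_wpM2l t1 IH; rewrite [in leRHS]mulrDr mulrA tE; lra.
Qed.
End Smooth.

(** * The deterministic quadratic bound on a set of blocks *)

Section Overapproximation.
Context {R : realType} {n : nat} {p : 'I_n -> nat}.
Local Notation N := (\sum_(i < n) p i)%N.
Variables (s : 'S_N) (B : forall i : 'I_n, 'M[R]_(p i)).
Hypothesis B_spd : forall i, spd_mx (B i).

Lemma bnormZ i (t : 'cV[R]_(p i)) (a : R) :
  0 <= a -> bnorm B (a *: t) = a * bnorm B t.
Proof.
move=> a0; rewrite /bnorm -scalemxAr dotZl dotZr mulrA -expr2.
by rewrite sqrtrM ?sqr_ge0// sqrtr_sqr ger0_norm.
Qed.

(** Cauchy-Schwarz for the form [B i], at [invmx (B i) *m u] and [t]. *)
Lemma dot_le_bnorm_dual i (u t : 'cV[R]_(p i)) :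
  dot u t <= bnorm_dual B u * bnorm B t.
Proof.
have := spd_mx_cauchy_schwarz (invmx (B i) *m u) t (B_spd i).
rewrite mulmxA mulmxV ?spd_mx_unit// mul1mx.
by rewrite [dot u (_ *m _)]dotC.
Qed.

(** The Lipschitz bound at [a *: t] and duality of the norms give the slope condition with
    [c = L i * bnorm B t ^+ 2]. *)
Lemma block_descent (f : 'cV[R]_N -> R) (L : 'I_n -> R) (x : 'cV[R]_N) i
    (t : 'cV[R]_(p i)) :
  (forall y, differentiable f y) -> block_lipschitz s B f L ->
  f (x + Ublk s i *m t) <=
    f x + dot (grad f x) (Ublk s i *m t) + L i * bnorm B t ^+ 2 / 2.
Proof.
move=> df lipf; apply: descent_line => // a a0.
rewrite dotBl -!dot_trmx -dotBl (le_trans (dot_le_bnorm_dual _ _))//.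
have := lipf x i (a *: t); rewrite bnormZ// -scalemxAr => H.
apply: (le_trans (ler_wpM2r (sqrtr_ge0 _) H)).
rewrite -/(bnorm B t); lra.
Qed.

Section Separable.
Variables (f : 'cV[R]_N -> R) (K : finType) (J : K -> {set 'I_n}).
Variable fJ : K -> 'cV[R]_N -> R.
Hypothesis f_sep : partially_separable s f J fJ.

Lemma partially_separable_differentiable x : differentiable f x.
Proof.
case: f_sep => fE fJP.
have -> : f = \sum_(j < #|K|) fJ (enum_val j).
  by apply/funext => y; rewrite fE fct_sumE (reindex_onto enum_val enum_rank)//=;
    [apply: eq_bigl => j; rewrite enum_valK eqxx | move=> k _; rewrite enum_rankK].
by apply: differentiable_sum => j; case: (fJP (enum_val j)).
Qed.

Lemma partially_separable_jensen (A : {set 'I_n}) (m : nat) x h :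
  (forall k, (#|J k :&: A| <= m.+1)%N) ->
  f (x + restr s h A) <= f x + m.+1%:R^-1 *
    \sum_(i in A) (f (x + m.+1%:R *: (Ublk s i *m blk s h i)) - f x).
Proof.
move=> leJ; case: f_sep => fE fJP.
under [in leRHS]eq_bigr do rewrite !fE -sumrB.
rewrite exchange_big !fE mulr_sumr -big_split/=; apply: ler_sum => k _.
have [_ cvx _ dep] := fJP k.
have m0 : m.+1%:R != 0 :> R by rewrite pnatr_eq0.
(* [fJ k] sees only the blocks of [h] in [J k :&: A]; scaling each by [m.+1] cancels the Jensen
   weight. *)
have -> : fJ k (x + restr s h A) = fJ k (x + m.+1%:R^-1 *:
    \sum_(i <- enum (J k :&: A)) m.+1%:R *: (Ublk s i *m blk s h i)).
  rewrite -scaler_sumr scalerA mulVf// scale1r big_enum_cond/=.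
  apply: dep => i iJ; rewrite !blkD; congr (_ + _).
  under eq_bigl do rewrite andbT.
  by rewrite -/(restr s h (J k :&: A)) !blk_restr inE iJ.
apply: le_trans (convex_jensen _ _ cvx _) _; first by rewrite -cardE.
rewrite big_enum_cond/= lerD2l ler_wpM2l ?invr_ge0//.
(* Indices of [A] outside [J k] contribute zero, so the sum from Jensen extends to all of [A], the
   same range for every [k]. *)
have out i : i \notin J k ->
    fJ k (x + m.+1%:R *: (Ublk s i *m blk s h i)) - fJ k x = 0.
  move=> iJ; apply/eqP; rewrite subr_eq0; apply/eqP; apply: dep => j jJ.
  rewrite blkD blkZ blk_Ublk_neq ?scaler0 ?addr0//.
  by apply: contraNneq iJ => <-.
rewrite [leRHS](bigID (mem (J k)))/= [X in _ + X]big1; last first.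
  by move=> i /andP[_ /out].
rewrite addr0 le_eqVlt; apply/orP; left; apply/eqP; apply: eq_bigl => i.
by rewrite inE andbT andbC.
Qed.

(** All summands are constant along this direction, so the difference quotients vanish. This handles
    blocks of zero weight. *)
Lemma partially_separable_dot_grad0 (A : {set 'I_n}) x h :
  (forall k, J k :&: A = finset.set0) -> dot (grad f x) (restr s h A) = 0.
Proof.
move=> J0; case: f_sep => fE fJP.
rewrite dot_grad; last exact: partially_separable_differentiable.
have fx a : f (a *: restr s h A + x) = f x.
  rewrite !fE; apply: eq_bigr => k _; have [_ _ _ dep] := fJP k.
  apply: dep => i iJ; rewrite blkD blkZ blk_restr.
  have /setP/(_ i) := J0 k; rewrite !inE iJ/= => ->.
  by rewrite scaler0 add0r.
rewrite /derive; apply: (@cvg_lim R) => //.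
under eq_fun do rewrite /= fx subrr scaler0.
exact: cvg_cst.
Qed.

Lemma partially_separable_overapprox (L : 'I_n -> R) (A : {set 'I_n}) x h :
  block_lipschitz s B f L ->
  f (x + restr s h A) <= f x + dot (grad f x) (restr s h A) +
    2^-1 * \sum_(i in A) (\max_(k : K) #|J k :&: A|)%N%:R * L i *
       bnorm B (blk s h i) ^+ 2.
Proof.
move=> lipf; have df := partially_separable_differentiable.
have lem k : (#|J k :&: A| <= \max_(k : K) #|J k :&: A|)%N.
  exact: (leq_bigmax k).
case: (\max_(k : K) _)%N lem => [|m] lem.
  have J0 k : J k :&: A = finset.set0.
    by apply/eqP; rewrite -cards_eq0 -leqn0.
  rewrite partially_separable_dot_grad0// addr0 [X in _ * X]big1; last first.
    by move=> i _; rewrite !mul0r.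
  suff -> : f (x + restr s h A) = f x by rewrite mulr0 addr0.
  case: f_sep => fE fJP; rewrite !fE; apply: eq_bigr => k _.
  have [_ _ _ dep] := fJP k; apply: dep => i iJ; rewrite blkD blk_restr.
  by have /setP/(_ i) := J0 k; rewrite !inE iJ/= => ->; rewrite addr0.
apply: le_trans (partially_separable_jensen x h lem) _.
have m0 : m.+1%:R != 0 :> R by rewrite pnatr_eq0.
rewrite -addrA lerD2l dot_sumr !mulr_sumr -big_split/=; apply: ler_sum => i _.
(* The stretched step yields [m.+1 ^+ 2] in the quadratic term; the factor [m.+1^-1] from Jensen
   leaves one [m.+1], which becomes the weight gamma. *)
have := block_descent x (m.+1%:R *: blk s h i) df lipf.
rewrite bnormZ// -scalemxAr dotZr => H.
have {}H : f (x + m.+1%:R *: (Ublk s i *m blk s h i)) - f x <=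
  m.+1%:R * dot (grad f x) (Ublk s i *m blk s h i) +
  L i * (m.+1%:R * bnorm B (blk s h i)) ^+ 2 / 2 by lra.
have m0' : 0 <= m.+1%:R^-1 :> R by rewrite invr_ge0.
apply: le_trans (ler_wpM2l m0' H) _.
by rewrite le_eqVlt; apply/orP; left; apply/eqP; field.
Qed.

End Separable.
End Overapproximation.

(** * Expectations and probabilities for samplings *)

Section SamplingTheory.
Context {R : realType} {n : nat} {d : measure_display} {T : measurableType d}.
Variables (P : probability T R) (S : T -> {set 'I_n}).

(** A function of [S] is a finite combination of indicators of the fibres of [S], so its integral is
    computed termwise. *)
Lemma expectation_sampling (g : {set 'I_n} -> R) : is_sampling S ->
  ('E_P[(fun t => g (S t))%R] =
   \sum_A (g A)%:E * P [set t | S t = A]%classic)%E.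
Proof.
move=> mS.
pose F (A : {set 'I_n}) (t : T) := ((g A)%:E * (\1_[set t | S t = A]%classic t)%:E)%E.
have iF A : P.-integrable setT (F A).
  by apply: integrableZl => //; exact: integrable_indic.
rewrite unlock; transitivity (\int[P]_t (\sum_A F A t)%R)%E.
  apply: eq_integral => t _; rewrite (bigD1 (S t))//= big1 => [|A AS].
    by rewrite addr0 /F indicE mem_set// mule1.
  rewrite /F indicE memNset ?mule0//= => SA; by rewrite SA eqxx in AS.
rewrite integral_sum//; apply: eq_bigr => A _.
rewrite integralZl//; last exact: integrable_indic.
by rewrite integral_indic// setIT.
Qed.

Lemma measurable_sampling (A : pred {set 'I_n}) : is_sampling S ->
  measurable [set t | A (S t)]%classic.
Proof.
move=> mS; rewrite (_ : mkset _ =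
  \big[setU/set0]_(C <- enum {set 'I_n} | A C) [set t | S t = C]%classic).
  by apply: bigsetU_measurable => C _; exact: mS.
apply/seteqP; split => [t /= At|t].
  by rewrite -bigcup_seq_cond; exists (S t) => //=; rewrite mem_enum.
by rewrite -bigcup_seq_cond => -[C /= /andP[_ AC] ->].
Qed.

Lemma probability_sampling (A : pred {set 'I_n}) : is_sampling S ->
  (P [set t | A (S t)]%classic =
   \sum_C (A C)%:R%:E * P [set t | S t = C]%classic)%E.
Proof.
move=> mS; rewrite -expectation_sampling// -expectation_indic.
  by congr expectation; apply/funext => t; rewrite indicE mem_setE.
exact: measurable_sampling.
Qed.

Section Nonoverlapping.
Variable Q : {set {set 'I_n}}.
Hypothesis nou : nonoverlapping_uniform P S Q.

Lemma nonoverlapping_sum (g : {set 'I_n} -> R) :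
  (\sum_A (g A)%:E * P [set t | S t = A]%classic =
   (#|Q|%:R^-1 * \sum_(A in Q) g A)%:E)%E.
Proof.
case: nou => _ _ PS; rewrite mulr_sumr [in RHS]big_mkcond/= -sumEFin.
apply: eq_bigr => A _; rewrite PS -EFinM mulrC; case: ifP => //.
by rewrite mul0r.
Qed.

(** Without cells every fibre would be null, against total probability 1. *)
Lemma nonoverlapping_card_gt0 : (0 < #|Q|)%N.
Proof.
case: nou => mS _ _; rewrite lt0n cards_eq0; apply/eqP => Q0.
have := probability_sampling xpredT mS; rewrite nonoverlapping_sum Q0.
rewrite big_set0 mulr0 (_ : mkset _ = setT) ?probability_setT.
  by move=> /eqP; rewrite eqe oner_eq0.
by apply/seteqP; split.
Qed.

(** Only the cell [pblock Q i] contains [i], so one term survives; properness and uniformity both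
    follow. *)
Lemma nonoverlapping_probability_mem i :
  P [set t | i \in S t]%classic = (#|Q|%:R^-1)%:E.
Proof.
case: nou => mS part _; rewrite (probability_sampling (fun A => i \in A))//.
rewrite nonoverlapping_sum; have /and3P[/eqP covQ trivQ _] := part.
have iQ : i \in finset.cover Q by rewrite covQ inE.
rewrite (bigD1 (finset.pblock Q i)) ?pblock_mem//= mem_pblock iQ big1.
  by rewrite addr0 mulr1.
move=> A /andP[AQ Ai]; case: (boolP (i \in A)) => // iA.
by rewrite (def_pblock trivQ AQ iA) eqxx in Ai.
Qed.

Lemma nonoverlapping_ae (p : pred {set 'I_n}) :
  (forall A, A \in Q -> p A) -> {ae P, forall t, p (S t)}.
Proof.
case: nou => mS _ _ pQ; exists [set t | ~~ p (S t)]%classic; split.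
- exact: (measurable_sampling (fun A => ~~ p A)).
- rewrite (probability_sampling (fun A => ~~ p A))// nonoverlapping_sum.
  by rewrite big1 ?mulr0// => A /pQ ->.
- by move=> t /= /negP.
Qed.
End Nonoverlapping.
End SamplingTheory.

(** * Separability of the model and its minimisers *)

Section Monotonic.
Context {R : realType} {n : nat} {p : 'I_n -> nat}.
Local Notation N := (\sum_(i < n) p i)%N.
Variables (s : 'S_N) (B : forall i : 'I_n, 'M[R]_(p i)).

Lemma gamma_weight_cell (Q : {set {set 'I_n}}) (K : finType)
    (J : K -> {set 'I_n}) (A : {set 'I_n}) i :
  finset.trivIset Q -> A \in Q -> i \in A ->
  gamma_weight Q J i = (\max_(k : K) #|J k :&: A|)%N%:R :> R.
Proof. by move=> tQ AQ iA; rewrite /gamma_weight (def_pblock tQ AQ iA). Qed.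

(** As no term is [-oo], one infinite term would make the sum [+oo]. This reduces the comparison of
    models to real arithmetic. *)
Lemma block_sum_fin_num (Om : forall i, 'cV[R]_(p i) -> \bar R)
    (z : forall i, 'cV[R]_(p i)) :
  (forall i, ninfty_free (Om i)) ->
  (\sum_i Om i (z i) < +oo)%E -> forall i, Om i (z i) \is a fin_num.
Proof.
move=> Omny; rewrite ltey => /eqP sumy i; rewrite fin_numE.
have ny j : Om j (z j) != -oo%E by have := Omny j (z j); rewrite ltNye.
rewrite ny/=; apply/eqP => Oiy; apply: sumy.
by apply/esum_eqyP => //; exists i; split => //; rewrite mem_index_enum.
Qed.

(* Comparing [h] with the competitor whose blocks in [A] are set to [0] cancels
   the contribution of the blocks outside [A]. *)
Lemma argmin_model_restr (f : 'cV[R]_N -> R) (Omega : 'cV[R]_N -> \bar R)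
    (beta : R) (w : 'I_n -> R) (x h : 'cV[R]_N) (A : {set 'I_n}) :
  (forall i, 0 <= w i) -> block_separable s Omega ->
  edom (composite f Omega) x ->
  is_argmin_model s B f Omega beta w x h ->
  (model s B f Omega beta w x (restr s h A) <= composite f Omega x)%E.
Proof.
move=> w0 [Om [OmP OmegaE]] domx argm.
have Omny i : ninfty_free (Om i) by case: (OmP i).
(* [q i] is the share of block [i] in the smooth part of the model. *)
pose q i t := dot (blk s (grad f x) i) t + beta / 2 * (w i * bnorm B t ^+ 2).
have q0 i : q i 0 = 0.
  by rewrite /q dot0r /bnorm mulmx0 dot0r sqrtr0 expr0n/= !mulr0 addr0.
have modelE h' : model s B f Omega beta w x h' =
    ((f x + \sum_i q i (blk s h' i))%:E +
     \sum_i Om i (blk s x i + blk s h' i)%R)%E.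
  rewrite /model OmegaE wnorm_sqr// (dot_blk s) mulr_sumr -addrA -big_split/=.
  by congr (_ + _)%E; apply: eq_bigr => i _; rewrite blkD.
have cE : composite f Omega x = ((f x)%:E + \sum_i Om i (blk s x i))%E.
  by rewrite /composite OmegaE.
have fin0 i : Om i (blk s x i) \is a fin_num.
  apply: (block_sum_fin_num (z := blk s x)) => //.
  by move: domx; rewrite /edom/= cE -lteBrDl// subey ltry.
have model0 : model s B f Omega beta w x 0 = composite f Omega x.
  have blk0 i : blk s (0 : 'cV[R]_N) i = 0 by exact: mulmx0.
  rewrite modelE cE big1 => [|i _]; last by rewrite blk0 q0.
  by rewrite addr0; congr (_ + _)%E; apply: eq_bigr => i _; rewrite blk0 addr0.
(* The competitor 0 has the finite value [composite f Omega x], so the minimal value is finite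
   too. *)
have finh i : Om i (blk s x i + blk s h i) \is a fin_num.
  apply: (block_sum_fin_num (z := fun i => blk s x i + blk s h i)) => //.
  have := argm 0; rewrite model0 modelE => /le_lt_trans/(_ domx).
  by rewrite -lteBrDl// subey ltry.
pose a i := fine (Om i (blk s x i)).
pose b i := fine (Om i (blk s x i + blk s h i)).
have modelE' (C : {set 'I_n}) : model s B f Omega beta w x (restr s h C) =
    (f x + \sum_i (if i \in C then q i (blk s h i) + b i else a i))%:E.
  rewrite modelE; have -> : (\sum_i Om i (blk s x i + blk s (restr s h C) i)%R
     = \sum_i (if i \in C then b i else a i)%:E)%E.
    apply: eq_bigr => i _; rewrite blk_restr.
    by case: ifP => _; rewrite ?addr0 /a /b fineK.
  rewrite sumEFin -EFinD -addrA -big_split/=; congr (_ + _)%:E.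
  by apply: eq_bigr => i _; rewrite blk_restr; case: ifP => _//; rewrite q0 add0r.
have cE' : composite f Omega x = (f x + \sum_i a i)%:E.
  by rewrite cE EFinD -sumEFin; congr (_ + _)%E; apply: eq_bigr => i _; rewrite fineK.
have := argm (restr s h (~: A)).
(* Writing [h] as its restriction to all blocks lets [modelE'] expand both sides. *)
have {1}-> : h = restr s h [set: 'I_n]%SET.
  by apply: (blk_ext (s := s)) => i; rewrite blk_restr inE.
rewrite !modelE' cE' !lee_fin !lerD2l.
rewrite -subr_ge0 -sumrB => H; rewrite -subr_ge0 -sumrB.
suff <- : \sum_(i < n)
  ((if i \in ~: A then q i (blk s h i) + b i else a i) -
   (if i \in [set: 'I_n]%SET then q i (blk s h i) + b i else a i)) =
 \sum_(i < n) (a i - (if i \in A then q i (blk s h i) + b i else a i)) by [].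
by apply: eq_bigr => i _; rewrite !inE; case: (i \in A) => //=; rewrite !subrr.
Qed.

End Monotonic.

(** * From the bound on cells to the ESO and monotonicity *)

Section NonoverlappingESO.
Context {R : realType} {n : nat} {p : 'I_n -> nat}.
Local Notation N := (\sum_(i < n) p i)%N.
Variables (s : 'S_N) (B : forall i : 'I_n, 'M[R]_(p i)).
Hypothesis B_spd : forall i, spd_mx (B i).
Variables (f : 'cV[R]_N -> R) (K : finType) (J : K -> {set 'I_n}).
Variables (fJ : K -> 'cV[R]_N -> R) (L : 'I_n -> R) (Q : {set {set 'I_n}}).
Hypotheses (f_sep : partially_separable s f J fJ) (f_lip : block_lipschitz s B f L).
Hypothesis L_gt0 : forall i, 0 < L i.
Hypothesis Q_part : finset.partition Q [set: 'I_n]%SET.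
Local Notation w := (wmul (gamma_weight Q J) L).

Lemma gamma_weight_L_ge0 i : 0 <= w i.
Proof. by rewrite mulr_ge0// ltW. Qed.

(** gamma is constant on a cell, equal to the maximum in the deterministic bound. *)
Lemma cell_overapprox (A : {set 'I_n}) x h : A \in Q ->
  f (x + restr s h A) <= f x + dot (grad f x) (restr s h A) +
    2^-1 * \sum_(i in A) w i * bnorm B (blk s h i) ^+ 2.
Proof.
move=> AQ; have /and3P[_ trivQ _] := Q_part.
apply: le_trans (partially_separable_overapprox B_spd f_sep A x h f_lip) _.
rewrite le_eqVlt; apply/orP; left; apply/eqP; congr (_ + _ * _).
by apply: eq_bigr => i iA; rewrite /wmul (gamma_weight_cell _ trivQ AQ iA).
Qed.

Lemma wnorm_sqr_restr (A : {set 'I_n}) h :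
  wnorm s B w (restr s h A) ^+ 2 = \sum_(i in A) w i * bnorm B (blk s h i) ^+ 2.
Proof.
rewrite wnorm_sqr; last exact: gamma_weight_L_ge0.
rewrite [RHS]big_mkcond/=; apply: eq_bigr => i _; rewrite blk_restr.
case: ifP => // _; by rewrite /bnorm mulmx0 dot0r sqrtr0 expr0n mulr0.
Qed.

Variables (d : measure_display) (T : measurableType d) (P : probability T R).
Variable S : T -> {set 'I_n}.
Hypothesis S_nou : nonoverlapping_uniform P S Q.

Lemma ESO_nonoverlapping : ESO P S s B f 1 w.
Proof.
have Q0 := nonoverlapping_card_gt0 S_nou.
have Q0' : #|Q|%:R != 0 :> R by rewrite pnatr_eq0 -lt0n.
have mS : is_sampling S by case: S_nou.
(* For [n = 0] every cell would be empty, which a partition forbids, yet [Q] has a cell. *)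
have n0 : n%:R != 0 :> R.
  rewrite pnatr_eq0; apply: contraTneq Q0 => n0; rewrite -leqNgt leqn0 cards_eq0.
  apply/eqP/setP => A; rewrite inE; apply/negP => AQ.
  have /and3P[_ _ /negP] := Q_part; apply.
  suff <- : A = finset.set0 by [].
  by apply/setP => i; have := ltn_ord i; rewrite {2}n0.
split => // [i|i j|x h]; rewrite ?(nonoverlapping_probability_mem S_nou)//.
  by rewrite lte_fin invr_gt0 ltr0n.
rewrite (expectation_sampling P (fun A => f (x + restr s h A)))//.
rewrite (expectation_sampling P (fun A => #|A|%:R))//.
rewrite !(nonoverlapping_sum S_nou) -!EFinM -EFinD lee_fin -natr_sum.
(* The cell sizes sum to [n], so the factor E|S| / n is [#|Q|^-1]; both sides then become averages
   over the cells, compared cell by cell. *)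
rewrite -(card_partition Q_part) cardsT card_ord mulfK//.
have -> : f x = #|Q|%:R^-1 * \sum_(A in Q) f x.
  by rewrite sumr_const -[f x *+ _]mulr_natl mulKf.
rewrite -mulrDr ler_pM2l ?invr_gt0 ?ltr0n//.
have -> : dot (grad f x) h = \sum_(A in Q) dot (grad f x) (restr s h A).
  rewrite -dot_sumr /restr -(set_partition_big _ Q_part)/=.
  congr dot; rewrite -[LHS](sum_Ublk_blk s).
  by apply: eq_bigl => i; rewrite inE.
rewrite wnorm_sqr; last exact: gamma_weight_L_ge0.
have -> : \sum_i w i * bnorm B (blk s h i) ^+ 2 =
    \sum_(A in Q) \sum_(i in A) w i * bnorm B (blk s h i) ^+ 2.
  by rewrite -(set_partition_big _ Q_part)/=; apply: eq_bigl => i; rewrite inE.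
rewrite mulr_sumr -!big_split/=; apply: ler_sum => A AQ.
by rewrite addrA mul1r cell_overapprox.
Qed.

(** On each cell [A], the deterministic bound puts the objective at [x + h_A] below the model at
    [h_A], which minimality of [h] puts below the objective at [x]. Almost surely [S] is a cell. *)
Lemma ESO_monotonic_nonoverlapping (Omega : 'cV[R]_N -> \bar R) :
  block_separable s Omega -> ESO_monotonic P S s B f Omega 1 w.
Proof.
move=> Om_sep x h domx argm.
apply: (nonoverlapping_ae S_nou (p := fun A =>
  (composite f Omega (x + restr s h A)%R <= composite f Omega x)%E)) => A AQ.
apply: le_trans (argmin_model_restr A gamma_weight_L_ge0 Om_sep domx argm).
rewrite /composite /model leeD2r// lee_fin wnorm_sqr_restr mul1r.
exact: cell_overapprox.
Qed.
End NonoverlappingESO.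

Theorem theorem13 (R : realType) (n : nat) (p : 'I_n -> nat)
  (p_gt0 : forall i, (0 < p i)%N)
  (s : 'S_(\sum_(i < n) p i)%N)
  (B : forall i : 'I_n, 'M[R]_(p i)) (B_spd : forall i, spd_mx (B i))
  (f : 'cV[R]_(\sum_(i < n) p i)%N -> R)
  (K : finType) (J : K -> {set 'I_n})
  (fJ : K -> 'cV[R]_(\sum_(i < n) p i)%N -> R)
  (f_sep : partially_separable s f J fJ)
  (L : 'I_n -> R) (L_gt0 : forall i, 0 < L i)
  (f_lip : block_lipschitz s B f L)
  (d : measure_display) (T : measurableType d) (P : probability T R)
  (S : T -> {set 'I_n}) (Q : {set {set 'I_n}})
  (S_nou : nonoverlapping_uniform P S Q) :
  ESO P S s B f 1 (wmul (gamma_weight Q J) L) /\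
  forall Omega : 'cV[R]_(\sum_(i < n) p i)%N -> \bar R,
    proper_fun Omega -> closed_fun Omega -> econvex Omega ->
    block_separable s Omega ->
    ESO_monotonic P S s B f Omega 1 (wmul (gamma_weight Q J) L).
Proof.
have Q_part : finset.partition Q [set: 'I_n]%SET by case: S_nou.
split; first exact: (ESO_nonoverlapping B_spd f_sep).
move=> Omega _ _ _ Om_sep.
exact: (ESO_monotonic_nonoverlapping B_spd f_sep).
Qed.
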